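(* Let $n\ge3$ be an integer. Then every double cone on $n$ vertices admits proper Laplacian fractional revival at time $2\pi/n$ between its two conical vertices. Moreover, this fractional revival is Laplacian perfect state transfer if and only if $n=4$.
   Context: For a graph $X$ with adjacency matrix $A$ and diagonal degree matrix $D$, the Laplacian is $L=D-A$ and the transition matrix is $U(t)=\exp(itL)$. $X$ admits Laplacian fractional revival from vertex $a$ to vertex $b\neq a$ at time $\tau$ if $U(\tau)e_a=\alpha e_a+\beta e_b$ for some complex $\alpha,\beta$; it is proper if $\beta\neq0$, and it is Laplacian perfect state transfer if $\alpha=0$. A double cone is a graph $\overline{K_2}+Y$: the disjoint union of two non-adjacent vertices (the conical vertices) and a graph $Y$, with both conical vertices joined to every vertex of $Y$. *)

(* Defs.v *)
From HB Require Import structures.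
From mathcomp Require Export all_boot all_order all_algebra.
From mathcomp Require Export all_classical all_reals all_analysis.
From mathcomp Require Export complex.

Set Implicit Arguments.
Unset Strict Implicit.
Unset Printing Implicit Defensive.

Import Order.TTheory GRing.Theory Num.Theory numFieldNormedType.Exports.
Local Open Scope ring_scope.
Local Open Scope classical_set_scope.
Local Open Scope complex_scope.

Record sgraph (V : finType) := SGraph {
  adj :> rel V;
  adj_sym : symmetric adj;
  adj_irr : irreflexive adj }.

Definition edgeless (V : finType) : sgraph V :=
  @SGraph V (fun _ _ => false) (fun _ _ => erefl) (fun _ => erefl).

Section Join.
Variables (V W : finType) (X : sgraph V) (Y : sgraph W).

Definition join_adj (u v : (V + W)%type) : bool :=
  match u, v with
  | inl x, inl x' => X x x'
  | inr y, inr y' => Y y y'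
  | _, _ => true
  end.

Fact join_adj_sym : symmetric join_adj.
Proof. by move=> [x|y] [x'|y'] //=; apply: adj_sym. Qed.

Fact join_adj_irr : irreflexive join_adj.
Proof. by move=> [x|y] /=; apply: adj_irr. Qed.

Definition graph_join : sgraph (V + W)%type := SGraph join_adj_sym join_adj_irr.

End Join.

Definition double_cone (W : finType) (Y : sgraph W) : sgraph ('I_2 + W)%type :=
  graph_join (edgeless 'I_2) Y.

(* MathComp matrices are indexed by ordinals: the rows and columns of the
   matrices below are indexed by V through enum_val / enum_rank. *)
Section GraphMatrices.
Variables (K : pzRingType) (V : finType) (X : sgraph V).

Definition degree (v : V) : nat := #|[set w | X v w]|.

Definition adjmx : 'M[K]_#|V| :=
  \matrix_(i, j) (X (enum_val i) (enum_val j))%:R.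

Definition degmx : 'M[K]_#|V| :=
  diag_mx (\row_j (degree (enum_val j))%:R).

Definition laplacian : 'M[K]_#|V| := degmx - adjmx.

Definition basis_vec (v : V) : 'cV[K]_#|V| := delta_mx (enum_rank v) 0.

End GraphMatrices.

Definition expmx (K : numFieldType) (n : nat) (A : 'M[K]_n) : 'M[K]_n :=
  limn (series (fun k : nat => (k`!%:R)^-1 *: A ^+ k)).

Section FractionalRevival.
Variables (R : realType) (V : finType) (X : sgraph V).

Definition transition (t : R) : 'M[R[i]]_#|V| :=
  expmx (('i * t%:C) *: laplacian R[i] X).

Definition revival (a b : V) (tau : R) (alpha beta : R[i]) : Prop :=
  a != b /\
  transition tau *m basis_vec R[i] a =
    alpha *: basis_vec R[i] a + beta *: basis_vec R[i] b.

Definition laplacian_FR (a b : V) (tau : R) : Prop :=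
  exists alpha beta : R[i], revival a b tau alpha beta.

Definition proper_laplacian_FR (a b : V) (tau : R) : Prop :=
  exists alpha beta : R[i], revival a b tau alpha beta /\ beta != 0.

Definition laplacian_PST (a b : V) (tau : R) : Prop :=
  exists alpha beta : R[i], revival a b tau alpha beta /\ alpha = 0.

End FractionalRevival.

(* Main.v *)
(* With [n] the order of the graph and [m = n - 2] the order of [Y], the
   Laplacian of the double cone fixes three explicit lines whatever [Y] is: the
   all-ones vector has eigenvalue [0], [e_a - e_b] has eigenvalue [m], and
   [n (e_a + e_b) - 2 * 1] has eigenvalue [n].  They span a space containing
   [e_a].  At time [2 pi / n] the eigenvalues [0] and [n] both contribute the
   phase [1], and [m] contributes [z = exp (- 4 pi i / n)], so that
   [U e_a = (1 + z) / 2 e_a + (1 - z) / 2 e_b].  Now [z <> 1] as [n >= 3], and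
   [z = -1] exactly when [n = 4]. *)
Require Import Defs.
From mathcomp Require Import ring lra.

Set Implicit Arguments.
Unset Strict Implicit.
Unset Printing Implicit Defensive.

Import Order.TTheory GRing.Theory Num.Theory numFieldNormedType.Exports.
Local Open Scope ring_scope.

(** * Matrix exponential on an eigenvector *)

Section MatrixExponential.
Local Open Scope classical_set_scope.
Variables (K : numFieldType) (n : nat).

(** A matrix neighbourhood contains a product of entrywise neighbourhoods [P i j], and finitely many
    [near] conditions can be intersected. *)
Lemma cvg_mx_coord (T : Type) (F : set_system T) (FF : Filter F) (m p : nat)
    (f : T -> 'M[K]_(m, p)) (M : 'M[K]_(m, p)) :
  (forall i j, (fun t => f t i j) @ F --> M i j) -> f @ F --> M.
Proof.
move=> cvf A [P MP sPA].
have : \forall t \near F, forall i j, P i j (f t i j).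
  by apply: filter_forall => i; apply: filter_forall => j; apply: cvf (MP i j).
by apply: filterS => t Pt; apply: sPA.
Qed.

Lemma series_mx_coord (m p : nat) (u : nat -> 'M[K]_(m, p)) N i j :
  series u N i j = series (fun k => u k i j) N.
Proof. by rewrite /series /= summxE. Qed.

(* [expmx] is a total [lim], which is meaningless unless the exponential series
   converges. *)
Definition expmx_summable (A : 'M[K]_n) :=
  forall i j, cvgn (series (fun k : nat => (k`!%:R)^-1 * (A ^+ k) i j)).

Lemma expmx_cvg (A : 'M[K]_n) : expmx_summable A ->
  series (fun k : nat => (k`!%:R)^-1 *: A ^+ k) @ \oo --> expmx A.
Proof.
move=> cvA.
pose M : 'M[K]_n := \matrix_(i, j)
  limn (series (fun k : nat => (k`!%:R)^-1 * (A ^+ k) i j)).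
have cvM : series (fun k : nat => (k`!%:R)^-1 *: A ^+ k) @ \oo --> M.
  apply: cvg_mx_coord => i j; rewrite mxE.
  have -> : (fun N => series (fun k : nat => (k`!%:R)^-1 *: A ^+ k) N i j) =
            series (fun k : nat => (k`!%:R)^-1 * (A ^+ k) i j).
    apply/funext => N; rewrite series_mx_coord; congr series.
    by apply/funext => k; rewrite mxE.
  exact: cvA.
by rewrite /expmx (cvg_lim _ cvM)//; apply: norm_hausdorff.
Qed.

Lemma mulmx_exp_eigen (A : 'M[K]_n) (v : 'cV[K]_n) (l : K) k :
  A *m v = l *: v -> A ^+ k *m v = l ^+ k *: v.
Proof.
move=> Av; elim: k => [|k IH]; first by rewrite !expr0 mul1mx scale1r.
by rewrite exprSr -mulmxE -mulmxA Av -scalemxAr IH scalerA exprS.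
Qed.

(** Each partial sum acts on [v] as the scalar partial sum of the series for [l]; taking limits
    entry by entry, uniqueness of limits identifies both sides. *)
Lemma expmx_eigen (A : 'M[K]_n) (v : 'cV[K]_n) (l z : K) : expmx_summable A ->
  A *m v = l *: v ->
  series (fun k : nat => (k`!%:R)^-1 * l ^+ k) @ \oo --> z ->
  expmx A *m v = z *: v.
Proof.
move=> /expmx_cvg cvA Av cvz; apply/colP => i; rewrite !mxE.
pose S := series (fun k : nat => (k`!%:R)^-1 *: A ^+ k).
pose s := series (fun k : nat => (k`!%:R)^-1 * l ^+ k).
have SvE N : \sum_j S N i j * v j 0 = s N * v i 0.
  have : S N *m v = s N *: v.
    rewrite /S /s /series /= mulmx_suml scaler_suml; apply: eq_bigr => k _.
    by rewrite -scalemxAl (mulmx_exp_eigen _ Av) scalerA.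
  by move=> /colP /(_ i); rewrite !mxE.
have cv1 : (fun N => \sum_j S N i j * v j 0) @ \oo -->
           \sum_j expmx A i j * v j 0.
  apply: (cvg_big add_continuous) => j _; apply: cvgMl.
  exact: (cvg_comp _ _ cvA (@coord_continuous _ _ _ i j (expmx A))).
have cv2 : (fun N => \sum_j S N i j * v j 0) @ \oo --> z * v i 0.
  by under eq_fun do rewrite SvE; apply: cvgMl.
exact: (cvg_unique (@norm_hausdorff _ _) cv1 cv2).
Qed.

End MatrixExponential.

(** * Complex series, Euler's formula, summability *)

Section ComplexSeries.
Local Open Scope classical_set_scope.
Local Open Scope complex_scope.
Variable R : realType.
Local Notation C := (R[i] : numClosedFieldType).

Lemma cvg_complex (u : nat -> C) (a b : R) :
  (fun k => complex.Re (u k)) @ \oo --> a ->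
  (fun k => complex.Im (u k)) @ \oo --> b -> u @ \oo --> (a +i* b : C).
Proof.
move=> cva cvb; apply/cvgrPdist_lt => -[e e'].
(* A positive complex number has zero imaginary part, so the tolerance is the real [e]. *)
rewrite ltcE /= => /andP[/eqP -> e0].
have e20 : 0 < e / 2 by rewrite divr_gt0.
move/cvgrPdist_lt: cva => /(_ _ e20) cva.
move/cvgrPdist_lt: cvb => /(_ _ e20) cvb.
near=> k.
have /= Ha : `|a - complex.Re (u k)| < e / 2 by near: k.
have /= Hb : `|b - complex.Im (u k)| < e / 2 by near: k.
case: (u k) Ha Hb => c d /= Ha Hb.
rewrite normc_def /= ltcR -[ltRHS](gtr0_norm e0) -sqrtr_sqr ltr_sqrt ?exprn_gt0//.
move: Ha Hb; rewrite !ltr_norml => /andP[? ?] /andP[? ?]; nra.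
Unshelve. all: by end_near. Qed.

Lemma Re_series (u : nat -> C) N :
  complex.Re (series u N) = series (fun k => complex.Re (u k)) N.
Proof. by apply: (big_morph (@complex.Re R)) => // -[? ?] [? ?]. Qed.

Lemma Im_series (u : nat -> C) N :
  complex.Im (series u N) = series (fun k => complex.Im (u k)) N.
Proof. by apply: (big_morph (@complex.Im R)) => // -[? ?] [? ?]. Qed.

Lemma cvg_series_complex (u : nat -> C) (a b : R) :
  series (fun k => complex.Re (u k)) @ \oo --> a ->
  series (fun k => complex.Im (u k)) @ \oo --> b ->
  series u @ \oo --> (a +i* b : C).
Proof.
move=> cva cvb; apply: cvg_complex.
- by under eq_fun do rewrite Re_series.
- by under eq_fun do rewrite Im_series.
Qed.

(** Since |Re z| and |Im z| are at most |z|, comparison with [v] makes both real series absolutely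
    convergent. *)
Lemma is_cvg_series_complex (u : nat -> C) (v : nat -> R) :
  (forall k, `|u k| <= (v k)%:C) -> cvgn (series v) -> cvgn (series u).
Proof.
move=> uv cvv.
have Im_le (z : C) : `|complex.Im z|%:C <= `|z|.
  by rewrite normc_def lecR -sqrtr_sqr ler_wsqrtr// lerDr sqr_ge0.
have cv (f : C -> R) : (forall z, `|f z|%:C <= `|z|) ->
    cvgn (series (fun k => f (u k))).
  move=> fle; apply: normed_cvg.
  have fv k : `|f (u k)| <= v k by rewrite -lecR (le_trans (fle _)).
  apply: series_le_cvg fv cvv => // k.
  by rewrite -ler0c (le_trans _ (uv k)).
have /cvg_ex [a cva] := cv _ (@normc_ge_Re R).
have /cvg_ex [b cvb] := cv _ Im_le.
by apply/cvg_ex; exists (a +i* b); apply: cvg_series_complex.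
Qed.

Definition cis (x : R) : C := cos x +i* sin x.

Lemma cis0 : cis 0 = 1. Proof. by rewrite /cis cos0 sin0. Qed.

Lemma cis2pi : cis (pi *+ 2) = 1. Proof. by rewrite /cis cos2pi sin2pi. Qed.

(** Euler's formula: ['i ^+ k] is a sign times ['i ^+ odd k], so even terms give the cosine series
    and odd terms the sine series. *)
Lemma cvg_cis (x : R) :
  series (fun k : nat => (k`!%:R)^-1 * ('i%R * x%:C) ^+ k : C) @ \oo --> cis x.
Proof.
pose c k : R := (-1) ^+ k./2 * x ^+ k / k`!%:R.
have E k : (k`!%:R)^-1 * ('i%R * x%:C) ^+ k = (c k)%:C * ('i%C) ^+ odd k :> C.
  have iE : ('i%C : C) ^+ k = (-1) ^+ k./2 * 'i%C ^+ odd k.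
    by rewrite -[in LHS](odd_double_half k) exprD -mul2n exprM sqr_i mulrC.
  rewrite /c !rmorphM /= fmorphV /= rmorph_nat !rmorphXn /= rmorphN1 exprMn.
  by rewrite -complexiE iE; ring.
apply: cvg_series_complex.
- have -> : (fun k : nat => complex.Re ((k`!%:R)^-1 * ('i%R * x%:C) ^+ k)) =
            cos_coeff x.
    apply/funext => k; rewrite E /cos_coeff /= -exprnP -!mulrA.
    rewrite [X in _ = _ * X]mulrA -/(c k).
    by case: (odd k); rewrite /= ?expr0 ?expr1 /=
      !(mulr0, mul0r, mulr1, mul1r, subr0).
  by rewrite unlock; apply: is_cvg_series_cos_coeff.
- have -> : (fun k : nat => complex.Im ((k`!%:R)^-1 * ('i%R * x%:C) ^+ k)) =
            sin_coeff x.
    apply/funext => k; rewrite E /sin_coeff /= -!mulrA.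
    case: (boolP (odd k)) => [ok|_]; last first.
      by rewrite expr0 /= !(mulr0, mul0r, addr0).
    (* The sine series takes its sign from [k.-1./2], which matches [k./2] for odd [k]; the even
       terms have just been seen to vanish. *)
    have -> : k.-1./2 = k./2.
      by case: k ok => //= k; rewrite uphalf_half => /negPf ->.
    rewrite [X in _ = _ * X]mulrA -/(c k) expr1 /=.
    by rewrite !(mulr0, mul0r, mulr1, mul1r, addr0).
  by rewrite unlock; apply: is_cvg_series_sin_coeff.
Qed.

(** An entry of a product is a sum of [n] terms, so each further power costs a factor [n * a]. *)
Lemma norm_mx_exp (n : nat) (A : 'M[C]_n) (a : R) k i j :
  (forall i j, `|A i j| <= a%:C) -> `|(A ^+ k) i j| <= ((n%:R * a) ^+ k)%:C.
Proof.
move=> Aa; elim: k i j => [|k IH] i j.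
  by rewrite !expr0 mxE; case: (_ == _); rewrite ?normr1 ?normr0 ?lecR ?ler01.
rewrite exprS -mulmxE mxE (le_trans (ler_norm_sum _ _ _))//.
apply: (@le_trans _ _ (\sum_(l < n) (a * (n%:R * a) ^+ k)%:C)).
  apply: ler_sum => l _; rewrite normrM rmorphM /=.
  by rewrite ler_pM.
by rewrite sumr_const card_ord -raddfMn/= -[X in X%:C <= _]mulr_natl mulrA -exprS.
Qed.

Lemma expmx_summableC (n : nat) (A : 'M[C]_n) : expmx_summable A.
Proof.
(* The norm of a complex number is itself typed as complex; [complex.Re] extracts its real value.
   The sum bounds every entry, so the exponential series at [n * a] dominates. *)
pose a : R := \sum_i \sum_j complex.Re `|A i j|.
have Aa i j : `|A i j| <= a%:C.
  have nE i' j' : `|A i' j'| = (complex.Re `|A i' j'|)%:C by rewrite normc_def.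
  have n0 i' j' : 0 <= complex.Re `|A i' j'| by rewrite -ler0c -nE.
  rewrite nE lecR /a (bigD1 i)//= (bigD1 j)//= -addrA lerDl addr_ge0//.
    by apply: sumr_ge0 => *; exact: n0.
  by apply: sumr_ge0 => *; apply: sumr_ge0 => *; exact: n0.
move=> i j; apply: (is_cvg_series_complex _ (is_cvg_series_exp_coeff (n%:R * a))).
move=> k; rewrite /exp_coeff /= normrM normfV normr_nat mulrC rmorphM /= fmorphV.
by rewrite rmorph_nat ler_wpM2r ?invr_ge0// norm_mx_exp.
Qed.

Lemma expmx_cis (n : nat) (A : 'M[C]_n) (v : 'cV[C]_n) (t l : R) :
  A *m v = l%:C *: v ->
  expmx (('i%R * t%:C) *: A) *m v = cis (t * l) *: v.
Proof.
move=> Av; apply: expmx_eigen (@cvg_cis (t * l)); first exact: expmx_summableC.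
by rewrite -scalemxAl Av scalerA rmorphM mulrA.
Qed.

End ComplexSeries.

(** * The Laplacian on vertex functions *)

Section LaplacianFunctions.
Variables (K : comPzRingType) (V : finType) (X : sgraph V).

(** Writing vectors as functions on vertices hides the ordinal indexing and permits case analysis on
    [inl] and [inr]. *)
Definition fun_vec (f : V -> K) : 'cV[K]_#|V| := \col_i f (enum_val i).

Lemma basis_vecE v : basis_vec K v = fun_vec (fun w => (w == v)%:R).
Proof.
apply/colP => i; rewrite !mxE andbT; congr (_%:R).
by rewrite -(inj_eq (@enum_val_inj _ _)) enum_rankK.
Qed.

Lemma laplacian_fun_vec (f : V -> K) :
  laplacian K X *m fun_vec f = fun_vec (fun v => \sum_(w | X v w) (f v - f w)).
Proof.
apply/colP => i; rewrite mulmxBl mul_diag_mx !mxE sumrB; congr (_ - _).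
  rewrite sumr_const mulr_natl; congr (_ *+ _).
  by apply: eq_card => w; apply/idP/idP => [/set_mem|/mem_set].
rewrite (reindex enum_rank)/=; last first.
  by exists enum_val => ? _; rewrite ?enum_rankK ?enum_valK.
rewrite [RHS]big_mkcond; apply: eq_bigr => w _; rewrite !mxE enum_rankK.
by case: (X _ w); rewrite ?mul1r ?mul0r.
Qed.

End LaplacianFunctions.

(** * Eigenvectors of the double cone *)

Section DoubleCone.
Variables (K : comPzRingType) (W : finType) (Y : sgraph W).
Local Notation X := (double_cone Y).
Local Notation V := ('I_2 + W)%type.

Lemma big_double_cone (v : V) (F : V -> K) :
  \sum_(w | X v w) F w =
  match v with
  | inl _ => \sum_y F (inr y)
  | inr y => \sum_c F (inl c) + \sum_(y' | Y y y') F (inr y')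
  end.
Proof.
rewrite big_sumType; case: v => [c|y] /=; last by [].
by rewrite big_pred0 // add0r.
Qed.

Definition conical_diff (a b : 'I_2) (v : V) : K :=
  if v is inl c then (c == a)%:R - (c == b)%:R else 0.

Definition conical_balance (v : V) : K := if v is inl _ then #|W|%:R else - 2.

Lemma laplacian_cst : laplacian K X *m fun_vec (fun=> 1) = 0.
Proof.
rewrite laplacian_fun_vec; apply/colP => i; rewrite !mxE big1// => w _.
by rewrite subrr.
Qed.

(** A conical vertex sees only the #|W| vertices of [Y], where the function is 0; at a vertex of [Y]
    the two conical values cancel. *)
Lemma laplacian_conical_diff (a b : 'I_2) :
  laplacian K X *m fun_vec (conical_diff a b) =
  #|W|%:R *: fun_vec (conical_diff a b).
Proof.
rewrite laplacian_fun_vec; apply/colP => i; rewrite !mxE big_double_cone.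
case: (enum_val i) => [c|y] /=.
  by rewrite sumr_const subr0 mulr_natl.
rewrite [X in _ + X]big1 => [|y' _]; last by rewrite subrr.
have sum1 (c : 'I_2) : \sum_(c' : 'I_2) (c' == c)%:R = 1 :> K.
  by rewrite (bigD1 c)//= eqxx big1 ?addr0 // => c' /negPf ->.
by rewrite addr0 mulr0 sumrB sumrB !sum1 big1//; ring.
Qed.

(** Each edge between a cone and [Y] carries the difference #|W| + 2, the order of the graph. A
    conical vertex has #|W| such edges, a vertex of [Y] has two, and edges inside [Y] contribute
    0. *)
Lemma laplacian_conical_balance :
  laplacian K X *m fun_vec conical_balance = #|{: V}|%:R *: fun_vec conical_balance.
Proof.
rewrite laplacian_fun_vec; apply/colP => i.
rewrite !mxE big_double_cone card_sum card_ord.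
case: (enum_val i) => [c|y] /=.
  by rewrite sumr_const natrD opprK -mulr_natl; ring.
rewrite [X in _ + X]big1 ?addr0 => [|y' _]; last by rewrite subrr.
by rewrite sumr_const card_ord natrD -mulr_natl; ring.
Qed.

Lemma ord2_neq (a b c : 'I_2) : a != b -> (c == b) = (c != a).
Proof. by move: a b c => [[|[|?]] ?] [[|[|?]] ?] [[|[|?]] ?]. Qed.

Lemma conical_balanceE (a b : 'I_2) : a != b ->
  fun_vec conical_balance + 2 *: fun_vec (fun=> 1) =
  #|{: V}|%:R *: (basis_vec K (inl a : V) + basis_vec K (inl b : V)).
Proof.
move=> ab; rewrite !basis_vecE; apply/colP => i; rewrite !mxE card_sum card_ord.
case: (enum_val i) => [c|y] /=; last by ring.
have inlE d : (inl c == inl d :> V) = (c == d) by [].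
rewrite !inlE (ord2_neq c ab) natrD.
by case: (c == a) => /=; ring.
Qed.

Lemma conical_diffE (a b : 'I_2) :
  fun_vec (conical_diff a b) =
  basis_vec K (inl a : V) - basis_vec K (inl b : V).
Proof.
rewrite !basis_vecE; apply/colP => i; rewrite !mxE.
by case: (enum_val i) => [c|y] //=; rewrite subrr.
Qed.

End DoubleCone.

Arguments conical_diff {K W} a b v.
Arguments conical_balance {K W} v.

(** * The transition matrix at the revival time *)

Section DoubleConeRevival.
Local Open Scope complex_scope.
Variables (R : realType) (W : finType) (Y : sgraph W).
Local Notation X := (double_cone Y).
Local Notation V := ('I_2 + W)%type.

Lemma transition_cis (G : finType) (Z : sgraph G) (t l : R) (f : G -> R[i]) :
  laplacian R[i] Z *m fun_vec f = l%:C *: fun_vec f ->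
  transition Z t *m fun_vec f = cis (t * l) *: fun_vec f.
Proof. exact: expmx_cis. Qed.

Lemma transition_conical (n : nat) (a b : 'I_2) : #|{: V}| = n -> a != b ->
  transition X (2 * pi / n%:R) *m basis_vec R[i] (inl a : V) =
  ((1 + cis (2 * pi / n%:R * #|W|%:R)) / 2) *: basis_vec R[i] (inl a : V) +
  ((1 - cis (2 * pi / n%:R * #|W|%:R)) / 2) *: basis_vec R[i] (inl b : V).
Proof.
move=> <- ab; set t : R := 2 * pi / _; set z := cis _.
set U := transition X t.
have n0 : (#|{: V}|%:R : R[i]) != 0 by rewrite pnatr_eq0 card_sum card_ord.
have Ud : U *m fun_vec (conical_diff a b) = z *: fun_vec (conical_diff a b).
  by apply: transition_cis; rewrite laplacian_conical_diff rmorph_nat.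
have Ug : U *m fun_vec (conical_balance) = fun_vec (conical_balance).
  rewrite (@transition_cis _ _ _ #|{: V}|%:R); last first.
    by rewrite laplacian_conical_balance rmorph_nat.
  have -> : t * #|{: V}|%:R = pi *+ 2.
    by rewrite divfK ?pnatr_eq0 ?card_sum ?card_ord// mulr_natl.
  by rewrite cis2pi scale1r.
have U1 : U *m fun_vec (fun=> 1) = fun_vec (fun=> 1).
  rewrite (@transition_cis _ _ _ 0); last by rewrite laplacian_cst scale0r.
  by rewrite mulr0 cis0 scale1r.
have dE := conical_diffE R[i] W a b.
have gE := conical_balanceE R[i] W ab.
set ea := basis_vec _ (inl a); set eb := basis_vec _ (inl b).
rewrite -/ea -/eb in dE gE.
(* This is the half-sum of [e_a] and [e_b], expressed through the two eigenvectors that [U] fixes;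
   adding half of [e_a - e_b] recovers [e_a]. *)
pose s : 'cV[R[i]]_#|{: V}| :=
  (2 * #|{: V}|%:R)^-1 *: (fun_vec conical_balance + 2 *: fun_vec (fun=> 1)).
have sE : s = 2^-1 *: (ea + eb) by rewrite /s gE scalerA invfM divfK.
have Us : U *m s = s by rewrite -scalemxAr mulmxDr -scalemxAr Ug U1.
have aE : ea = 2^-1 *: fun_vec (conical_diff a b) + s.
  rewrite dE sE; move: (ea) (eb) => u v.
  by apply/colP => i; rewrite !mxE; field.
rewrite [in LHS]aE mulmxDr -scalemxAr Ud Us sE dE.
move: (z) (ea) (eb) => w u v.
by apply/colP => i; rewrite !mxE; field.
Qed.

End DoubleConeRevival.

(** * The phase at angle 2 pi - 2 y *)

Lemma cis2piB (R : realType) (y : R) :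
  cis (pi *+ 2 - y) = (cos y -i* sin y)%C.
Proof.
have := cosD2pi (- y); have := sinD2pi (- y).
by rewrite /cis addrC => -> ->; rewrite cosN sinN.
Qed.

(** The real part suffices: cos (2 y) = 1 would force sin y = 0, but the sine is positive on the
    open interval. *)
Lemma cis2piB_eq1 (R : realType) (y : R) : 0 < y < pi ->
  cis (pi *+ 2 - y *+ 2) != 1.
Proof.
move=> /sin_gt0_pi siny; rewrite cis2piB cos_mulr2n eq_complex /= negb_and.
apply/orP; left; have := cos2Dsin2 y; apply: contra_eq_neq => cy.
by have : 0 < sin y ^+ 2 by [rewrite exprn_gt0]; lra.
Qed.

(** If cos (2 y) = -1 then cos y = 0, and the cosine is injective on [0, pi]. *)
Lemma cis2piB_eqN1 (R : realType) (y : R) : 0 < y < pi ->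
  cis (pi *+ 2 - y *+ 2) = -1 <-> y = pi / 2.
Proof.
move=> /andP[y0 ypi]; rewrite cis2piB; split=> [[cy _]|->].
  apply: cos_inj; rewrite ?in_itv/=.
  - by rewrite !ltW.
  - by rewrite divr_ge0 ?pi_ge0//= ler_pdivrMr// ler_peMr ?pi_ge0 ?ler1n.
  - rewrite cos_pihalf; apply/eqP; rewrite -sqrf_eq0; apply/eqP.
    by move: cy; rewrite cos_mulr2n; lra.
have -> : pi / 2 *+ 2 = pi :> R by rewrite -mulr_natr divfK.
by rewrite cospi sinpi; apply/eqP; rewrite eq_complex /= !oppr0 !eqxx.
Qed.

Theorem theorem5p3 (R : realType) (n : nat) (hn : (3 <= n)%N)
    (W : finType) (Y : sgraph W) (hcard : #|{: 'I_2 + W}| = n)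
    (a b : 'I_2) (hab : a != b) :
  proper_laplacian_FR (double_cone Y) (inl a) (inl b) (2 * pi / n%:R : R) /\
  (laplacian_PST (double_cone Y) (inl a) (inl b) (2 * pi / n%:R : R) <->
   n = 4%N).
Proof.
have := transition_conical R Y hcard hab.
set y : R := 2 * pi / n%:R.
have n_gt0 : 0 < n%:R :> R by rewrite ltr0n; apply: leq_trans hn.
have yW : y * #|W|%:R = pi *+ 2 - y *+ 2.
  have -> : #|W|%:R = n%:R - 2 :> R.
    by rewrite -hcard card_sum card_ord natrD; ring.
  by rewrite /y; field; rewrite gt_eqF.
(* The upper bound amounts to 2 < [n]. *)
have y_itv : 0 < y < pi.
  rewrite divr_gt0 ?mulr_gt0 ?pi_gt0 //= ltr_pdivrMr// mulrC ltr_pM2l ?pi_gt0//.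
  by rewrite ltr_nat.
rewrite yW; have := cis2piB_eq1 y_itv; have := cis2piB_eqN1 y_itv.
set z := cis _ => zN1 z_neq1 Uab.
have revab : revival (double_cone Y) (inl a) (inl b) y
    ((1 + z) / 2) ((1 - z) / 2).
  by split.
split.
  exists ((1 + z) / 2), ((1 - z) / 2); split=> //.
  by rewrite mulf_neq0 ?invr_eq0 ?pnatr_eq0// subr_eq0 eq_sym.
have <- : y = pi / 2 <-> n = 4%N.
  split=> [ypi|n4]; last first.
    by rewrite /y n4; field.
  apply/eqP; rewrite -(eqr_nat R); apply/eqP.
  have : y * n%:R = 2 * pi by rewrite divfK ?gt_eqF.
  rewrite ypi => E; apply: (mulfI (lt0r_neq0 (pi_gt0 R))); lra.
rewrite -zN1; split=> [[alpha [beta [[_ Uab'] alpha0]]]|z1]; last first.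
  exists ((1 + z) / 2), ((1 - z) / 2); split; first exact: revab.
  by rewrite z1 subrr mul0r.
(* The witnesses are arbitrary, so the entry at [inl a] is compared with the computed image: (1 + z)
   / 2 must equal [alpha], which is 0. *)
move: Uab'; rewrite Uab => /colP /(_ (enum_rank (inl a : 'I_2 + W)%type)).
rewrite alpha0 !mxE !eqxx (inj_eq enum_rank_inj).
have -> : (inl a == inl b :> 'I_2 + W) = false by exact: negbTE.
rewrite !mulr0 !addr0 mulr1 mul0r => /eqP.
by rewrite mulf_eq0 invr_eq0 pnatr_eq0 orbF addrC addr_eq0 => /eqP.
Qed.
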